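(* Consider the one-dimensional Maxwell--Debye finite difference scheme of Joseph et al. (coupling the variables $B$, $E$, $D$), with parameters $\epsilon_0,\mu_0,\epsilon_\infty,t_r,\delta t,\delta x>0$ and $\epsilon_s\ge\epsilon_\infty$, and let $c_\infty=1/\sqrt{\epsilon_0\epsilon_\infty\mu_0}$. The scheme is stable under the following condition: (i) if $\epsilon_s>\epsilon_\infty$: $\ \delta t\le \delta x/c_\infty$; (ii) if $\epsilon_s=\epsilon_\infty$: $\ \delta t< \delta x/c_\infty$.
   Context: The scheme is, for $j,n$ integers, $$\tfrac1{\delta t}(B_{j+1/2}^{n+1/2}-B_{j+1/2}^{n-1/2})=-\tfrac1{\delta x}(E_{j+1}^n-E_j^n),\qquad \tfrac1{\delta t}(D_j^{n+1}-D_j^n)=-\tfrac1{\mu_0\delta x}(B_{j+1/2}^{n+1/2}-B_{j-1/2}^{n+1/2}),$$ $$\epsilon_0\epsilon_\infty t_r\frac{E_j^{n+1}-E_j^n}{\delta t}+\epsilon_0\epsilon_s\frac{E_j^{n+1}+E_j^n}{2}=t_r\frac{D_j^{n+1}-D_j^n}{\delta t}+\frac{D_j^{n+1}+D_j^n}{2}.$$ Put $\lambda=c_\infty\delta t/\delta x$, $\delta=\delta t/(2t_r)$, $\epsilon_s'=\epsilon_s/\epsilon_\infty$ and, for $\xi\in\mathbb R$, $\sigma=\lambda(e^{i\xi}-1)$, $q=|\sigma|^2=4\lambda^2\sin^2(\xi/2)$; a star denotes complex conjugation. For plane waves $U_j^n=U^n e^{i\xi j}$ in the variable $U_j^n=(c_\infty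 B_{j+1/2}^{n-1/2},E_j^n,D_j^n/(\epsilon_0\epsilon_\infty))^t$ the scheme reads $U^{n+1}=G(\xi)U^n$ with amplification matrix $$G(\xi)=\begin{pmatrix}1&-\sigma&0\\ \frac{(1+\delta)\sigma^*}{1+\delta\epsilon_s'}&\frac{(1-\delta\epsilon_s')-(1+\delta)q}{1+\delta\epsilon_s'}&\frac{2\delta}{1+\delta\epsilon_s'}\\ \sigma^*&-q&1\end{pmatrix}.$$ Stability (in the sense of von Neumann) means: for every $\xi\in\mathbb R$, the sequence of powers $(G(\xi)^n)_{n\ge0}$ is bounded. *)

(* Defs.v *)
From HB Require Import structures.
From mathcomp Require Import all_boot all_order all_algebra.
From mathcomp Require Import all_classical all_reals all_analysis.
From mathcomp Require Import complex.
From mathcomp Require Import ring.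

Set Implicit Arguments.
Unset Strict Implicit.
Unset Printing Implicit Defensive.

Import Order.TTheory GRing.Theory Num.Theory.
Import numFieldNormedType.Exports.

Local Open Scope complex_scope.
Local Open Scope ring_scope.

Record debye_params (R : Type) := DebyeParams {
  eps0 : R; mu0 : R; epsinf : R; epss : R; tr : R; dt : R; dx : R }.

Section Scheme.
Variables (R : realType) (p : debye_params R).

Definition cinf : R := (Num.sqrt (eps0 p * epsinf p * mu0 p))^-1.
Definition lam : R := cinf * dt p / dx p.
Definition del : R := dt p / (2 * tr p).
Definition epss' : R := epss p / epsinf p.

(* Half-integer indices are shifted to integers: [B j n] stands for
   B_{j+1/2}^{n-1/2}, while [E j n] and [D j n] stand for E_j^n and D_j^n. *)
Definition maxwell_debye (B E D : int -> int -> R[i]) : Prop :=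
  forall j n : int,
  [/\ (B j (n + 1) - B j n) / (dt p)%:C = - ((E (j + 1) n - E j n) / (dx p)%:C),
      (D j (n + 1) - D j n) / (dt p)%:C =
        - ((B j (n + 1) - B (j - 1) (n + 1)) / (mu0 p * dx p)%:C)
    & (eps0 p * epsinf p * tr p)%:C * ((E j (n + 1) - E j n) / (dt p)%:C)
      + (eps0 p * epss p)%:C * ((E j (n + 1) + E j n) / 2) =
      (tr p)%:C * ((D j (n + 1) - D j n) / (dt p)%:C)
      + (D j (n + 1) + D j n) / 2].

Definition expi (x : R) : R[i] := cos x +i* sin x.

Definition sigma (xi : R) : R[i] := lam%:C * (expi xi - 1).

Definition q (xi : R) : R[i] := `|sigma xi| ^+ 2.

Definition amplification (xi : R) : 'M[R[i]]_3 :=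
  let s := sigma xi in
  let d := del%:C in
  let e := epss'%:C in
  \matrix_(i, j)
    (nth [::]
      [:: [:: 1; - s; 0];
          [:: (1 + d) * s^* / (1 + d * e);
              ((1 - d * e) - (1 + d) * q xi) / (1 + d * e);
              2 * d / (1 + d * e)];
          [:: s^*; - q xi; 1]] i)`_j.

Lemma expiD (x y : R) : expi (x + y) = expi x * expi y.
Proof.
by rewrite /expi cosD sinD; apply/eqP;
rewrite eq_complex /= eqxx (addrC (sin x * _)) eqxx.
Qed.

Lemma expi0 : expi 0 = 1.
Proof. by rewrite /expi cos0 sin0. Qed.

Lemma expi_neq0 (x : R) : expi x != 0.
Proof.
apply/eqP => e; have := expiD x (- x).
by rewrite subrr expi0 e mul0r => /eqP; rewrite oner_eq0.
Qed.

Lemma conj_sigma (xi : R) : (sigma xi)^* = lam%:C * (expi (- xi) - 1).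
Proof.
apply/eqP; rewrite eq_complex /= cosN sinN.
by apply/andP; split; apply/eqP; ring.
Qed.

Lemma qE (xi : R) : q xi = (4 * lam ^+ 2 * sin (xi / 2) ^+ 2)%:C.
Proof.
have hxi : xi = xi / 2 + xi / 2 by field.
rewrite /q normCK conj_sigma /sigma.
have cE : cos xi = 1 - 2 * sin (xi / 2) ^+ 2.
  by rewrite {1}hxi cosD -!expr2 cos2sin2; ring.
have sc := cos2Dsin2 xi.
apply/eqP; rewrite eq_complex /= cosN sinN; apply/andP; split; apply/eqP; last first.
  by ring.
rewrite [LHS](_ : _ = lam ^+ 2 * ((cos xi ^+ 2 + sin xi ^+ 2) + 1 - 2 * cos xi)).
  by rewrite sc cE; ring.
by ring.
Qed.

(* For plane waves in the variable U = (cinf B, E, D / (eps0 epsinf))^t,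
   the scheme is the recurrence with matrix [amplification]. *)
Lemma maxwell_debye_plane_wave (xi : R) (U : int -> 'cV[R[i]]_3) :
  0 < eps0 p -> 0 < mu0 p -> 0 < epsinf p -> 0 < epss p ->
  0 < tr p -> 0 < dt p -> 0 < dx p ->
  maxwell_debye
    (fun j n => (cinf^-1)%:C * U n 0 0 * expi (xi * j%:~R))
    (fun j n => U n 1 0 * expi (xi * j%:~R))
    (fun j n => (eps0 p * epsinf p)%:C * U n 2 0 * expi (xi * j%:~R)) <->
  forall n : int, U (n + 1) = amplification xi *m U n.
Proof.
move=> e0 m0 ei es t0 dt0 dx0.
have c0 : 0 < cinf by rewrite invr_gt0 sqrtr_gt0 !mulr_gt0.
have mE : mu0 p = (cinf ^+ 2 * eps0 p * epsinf p)^-1.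
  rewrite /cinf exprVn sqr_sqrtr; last by rewrite !mulr_ge0 // ltW.
  by field; rewrite !gt_eqF.
have RC (x : R) : 0 < x -> x%:C != 0.
  by move=> x0; rewrite fmorph_eq0 gt_eqF.
have CM (x y : R) : (x * y)%:C = x%:C * y%:C by exact: rmorphM.
have CV (x : R) : (x^-1)%:C = x%:C^-1 by exact: fmorphV.
have lE : lam%:C = cinf%:C * (dt p)%:C / (dx p)%:C by rewrite /lam !CM (CV (dx p)).
have dE : del%:C = (dt p)%:C / (2 * (tr p)%:C).
  by rewrite /del CM CV CM; congr (_ / (_ * _)); exact: rmorph_nat.
have eE : epss'%:C = (epss p)%:C / (epsinf p)%:C by rewrite /epss' CM CV.
have den0 : 1 + del%:C * epss'%:C != 0.
  rewrite -(rmorph1 (real_complex R)) -rmorphM -rmorphD RC //.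
  by rewrite addr_gt0 // mulr_gt0 // ?divr_gt0 // mulr_gt0.
pose w := expi xi; pose w' := expi (- xi).
have ww' : w * w' = 1 by rewrite -expiD subrr expi0.
have w'w : w' = w^-1.
  by apply: (mulfI (expi_neq0 xi)); rewrite -/w ww' divff ?expi_neq0.
have w0 : w != 0 by exact: expi_neq0.
have sE : sigma xi = lam%:C * (w - 1) by [].
have scE : (sigma xi)^* = lam%:C * (w' - 1) by exact: conj_sigma.
have q'E : q xi = lam%:C ^+ 2 * (w - 1) * (w' - 1).
  by rewrite /q normCK scE sE; ring.
have eD (j : int) : expi (xi * (j + 1)%:~R) = expi (xi * j%:~R) * w.
  by rewrite intrD mulrDr mulr1 expiD.
have eB (j : int) : expi (xi * (j - 1)%:~R) = expi (xi * j%:~R) * w'.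
  by rewrite intrB mulrBr mulr1 expiD.
have step n : (U (n + 1) = amplification xi *m U n) <->
  [/\ U (n + 1) 0 0 = U n 0 0 - sigma xi * U n 1 0,
      U (n + 1) 2 0 = (sigma xi)^* * U n 0 0 - q xi * U n 1 0 + U n 2 0
    & U (n + 1) 1 0 = (((1 + del%:C) * (sigma xi)^*) * U n 0 0 +
         ((1 - del%:C * epss'%:C) - (1 + del%:C) * q xi) * U n 1 0 +
         2 * del%:C * U n 2 0) / (1 + del%:C * epss'%:C)].
  have mulE i : (amplification xi *m U n) i 0 = amplification xi i 0 * U n 0 0
      + amplification xi i 1 * U n 1 0 + amplification xi i 2 * U n 2 0.
    rewrite mxE !big_ord_recl big_ord0 addr0 addrA.
    by do ![congr (_ + _)]; congr (amplification _ _ _ * U _ _ _); apply/val_inj.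
  split=> [->|[h0 h2 h1]].
    by rewrite !mulE !mxE /=; split; [ring | ring | field].
  apply/colP => i; rewrite mulE.
  case: i => [[|[|[|//]]]] hi.
  - have -> : Ordinal hi = 0 by apply/val_inj.
    by rewrite h0 !mxE /=; ring.
  - have -> : Ordinal hi = 1 by apply/val_inj.
    by rewrite h1 !mxE /=; field.
  - have -> : Ordinal hi = 2 by apply/val_inj.
    by rewrite h2 !mxE /=; ring.
have mCE : (mu0 p)%:C = (cinf%:C ^+ 2 * (eps0 p)%:C * (epsinf p)%:C)^-1.
  by rewrite mE CV 2!CM expr2 CM -expr2.
have key j : forall b e d b' e' d' : R[i],
  let z := expi (xi * j%:~R) in
  [/\ ((cinf^-1)%:C * b' * z - (cinf^-1)%:C * b * z) / (dt p)%:C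
        = - ((e * (z * w) - e * z) / (dx p)%:C),
      (((eps0 p * epsinf p)%:C * d' * z - (eps0 p * epsinf p)%:C * d * z)
         / (dt p)%:C = - (((cinf^-1)%:C * b' * z - (cinf^-1)%:C * b' * (z * w'))
         / (mu0 p * dx p)%:C))
    & (eps0 p * epsinf p * tr p)%:C * ((e' * z - e * z) / (dt p)%:C)
      + (eps0 p * epss p)%:C * ((e' * z + e * z) / 2) =
      (tr p)%:C * (((eps0 p * epsinf p)%:C * d' * z
                      - (eps0 p * epsinf p)%:C * d * z) / (dt p)%:C)
      + ((eps0 p * epsinf p)%:C * d' * z + (eps0 p * epsinf p)%:C * d * z) / 2]
  <->
  [/\ b' = b - sigma xi * e,
      d' = (sigma xi)^* * b - q xi * e + d
    & e' = (((1 + del%:C) * (sigma xi)^*) * b +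
         ((1 - del%:C * epss'%:C) - (1 + del%:C) * q xi) * e +
         2 * del%:C * d) / (1 + del%:C * epss'%:C)].
  move=> b e d b' e' d' z; have z0 : z != 0 by exact: expi_neq0.
  move: den0; rewrite scE q'E sE lE dE eE w'w !CM (CV cinf) mCE.
  move: z z0 (w) w0 (RC _ c0) (RC _ e0) (RC _ ei) (RC _ es) (RC _ t0) (RC _ dt0) (RC _ dx0).
  move: (cinf%:C) ((eps0 p)%:C) ((epsinf p)%:C) ((epss p)%:C) ((tr p)%:C) ((dt p)%:C) ((dx p)%:C).
  move=> c p0 pi ps t h k z z0 v v0 cn0 pn0 pin0 psn0 tn0 hn0 kn0 den0.
  have den1 : 2 * t * pi + h * ps != 0.
    apply: contra_neq den0 => den0.
    have -> : ps = - (2 * t * pi) / h.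
      by apply: (mulIf hn0); rewrite divfK // -[RHS]add0r -den0; ring.
    by field; rewrite ?pin0 ?hn0 ?tn0.
  have two0 : 2 != 0 :> R[i] by rewrite pnatr_eq0.
  have side := (two0, cn0, pn0, pin0, psn0, tn0, hn0, kn0, z0, v0, den1).
  have z1 (x y : R[i]) : x = y <-> x - y = 0 by split=> [->|/subr0_eq //]; rewrite subrr.
  split=> [[/z1 h1 /z1 h2 /z1 h3]|[-> -> ->]]; last first.
    by split; field; rewrite !side.
  have b'E : b' = b - c * h / k * (v - 1) * e.
    by apply/z1; rewrite -[RHS](mulr0 (c * h / z)) -h1; field; rewrite !side.
  rewrite {}b'E in h1 h2 *.
  have d'E : d' = c * h / k * (v^-1 - 1) * b
      - (c * h / k) ^+ 2 * (v - 1) * (v^-1 - 1) * e + d.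
    apply/z1; rewrite -[RHS](mulr0 (h / (p0 * pi * z))) -h2; field.
    by rewrite !side.
  rewrite {}d'E in h2 h3 *.
  split=> //.
  apply/z1.
  rewrite -[RHS](mulr0 (2 * h / (p0 * z * (2 * t * pi + h * ps)))) -h3; field.
  by rewrite !side.
split=> [H n|H j n].
  by apply/step; have := H 0 n; rewrite eD eB => /(key 0).
by have /step/(key j) := H n; rewrite eD eB; exact.
Qed.

(* [bounded_fun] refers to the (max) norm of 'M[R[i]]_3. *)
Definition von_neumann_stable : Prop :=
  forall xi : R, bounded_fun (fun n : nat => amplification xi ^+ n).

End Scheme.

(* Main.v *)
Require Import Defs.
From HB Require Import structures.
From mathcomp Require Import all_boot all_order all_algebra.
From mathcomp Require Import all_classical all_reals all_analysis.
From mathcomp Require Import complex ring.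

(** With the polarisation p = d - e, the discrete energy
    |e|^2 + Re (b' b^* ) + |p|^2 / (epss' - 1) decreases at each step by
    |p' - p|^2 / (delta (epss' - 1)), and it is positive definite as long as
    q < 4.  At q = 4 it degenerates along an eigenvector of eigenvalue -1, and
    adding the squared modulus of the left eigenvector restores definiteness;
    this left eigenvector exists because epss' > 1 keeps -1 a simple eigenvalue.
    If epss' = 1 the polarisation decouples and decays; subtracting its
    eigenvector from (b, e) leaves the leapfrog scheme for the wave equation,
    whose energy is conserved and definite for q < 4. *)

Import Order.TTheory GRing.Theory Num.Theory.

Local Open Scope ring_scope.

(** * Lyapunov functionals and bounded powers *)

Definition dominated {C : numDomainType} {T : Type} (V l : T -> C) : Prop :=
  exists2 c : C, 0 <= c & forall v, `|l v| ^+ 2 <= c * V v.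

Lemma dominated_ge {C : numFieldType} {T : Type} {V l : T -> C} (c : C) :
  0 < c -> (forall v, c * `|l v| ^+ 2 <= V v) -> dominated V l.
Proof.
move=> c0 h; exists c^-1; first by rewrite invr_ge0 ltW.
by move=> v; rewrite mulrC ler_pdivlMr // mulrC.
Qed.

(** Parallelogram law: twice the sum of the squared moduli exceeds [|l + m|^2] by [|l - m|^2]. *)
Lemma dominatedD {C : numClosedFieldType} {T : Type} {V l m : T -> C} :
  dominated V l -> dominated V m -> dominated V (fun v => l v + m v).
Proof.
move=> [c c0 hc] [k k0 hk]; exists (2 * (c + k)); first by rewrite mulr_ge0 ?addr_ge0.
move=> v; rewrite -mulrA [(c + k) * _]mulrDl.
apply: (@le_trans _ _ (2 * (`|l v| ^+ 2 + `|m v| ^+ 2))); last first.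
  by rewrite ler_pM2l ?ltr0n // lerD.
rewrite -subr_ge0 (_ : _ - _ = `|l v - m v| ^+ 2) ?exprn_ge0 //.
by rewrite !normCK !rmorphB !rmorphD /=; ring.
Qed.

Lemma dominatedZ {C : numDomainType} {T : Type} {V l : T -> C} (a : C) :
  dominated V l -> dominated V (fun v => a * l v).
Proof.
move=> [c c0 hc]; exists (`|a| ^+ 2 * c); first by rewrite mulr_ge0 ?exprn_ge0.
by move=> v; rewrite normrM exprMn -[leRHS]mulrA ler_wpM2l ?exprn_ge0.
Qed.

Lemma eq_dominated {C : numDomainType} {T : Type} {V l m : T -> C} :
  l =1 m -> dominated V l -> dominated V m.
Proof. by move=> lm [c c0 hc]; exists c => // v; rewrite -lm. Qed.

(** [V] is a Lyapunov function: column [j] of [A ^+ k] is the image of a basis vector, so its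
    [V]-value stays below [V (delta_mx j 0)] for all [k]. *)
Lemma bounded_powers {K : numFieldType} {n : nat} (A : 'M[K]_n.+1)
    (V : 'cV[K]_n.+1 -> K) :
  (forall v, V (A *m v) <= V v) ->
  (forall i, dominated V (fun v => v i 0)) ->
  bounded_fun (fun k : nat => A ^+ k).
Proof.
move=> AV dom.
(* Passes from squared moduli to moduli without square roots, by [2 x <= 1 + x^2]. *)
have sqle (x y : K) : 0 <= x -> x ^+ 2 <= y -> x <= 1 + y.
  move=> x0 xy; apply: (@le_trans _ _ (x + x)); first by rewrite /V lerDl.
  apply: (@le_trans _ _ (1 + x ^+ 2)); last by rewrite lerD2l.
  rewrite -subr_ge0 (_ : _ - _ = (x - 1) ^+ 2); last by ring.
  by rewrite real_exprn_even_ge0 // rpredB ?ger0_real.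
have /all_sig2[c c0 hc] : forall i, {c : K | 0 <= c & forall v : 'cV_n.+1, `|v i 0| ^+ 2 <= c * V v}.
  by move=> i; apply: cid2; exact: dom.
have Vk k v : V (A ^+ k *m v) <= V v.
  elim: k => [|k IHk]; first by rewrite expr0 mul1mx.
  by rewrite exprS -mulmxE -mulmxA (le_trans (AV _)).
pose V1 (j : 'I_n.+1) := V (delta_mx j 0).
have cV0 i j : 0 <= c i * V1 j by apply: le_trans (hc i _); rewrite exprn_ge0.
pose M := 1 + \sum_i \sum_j c i * V1 j.
have M0 : 0 <= M by rewrite addr_ge0 ?ler01 ?sumr_ge0 // => i _; rewrite sumr_ge0.
have AM k i j : `|(A ^+ k) i j| <= M.
  apply: sqle => //; rewrite (bigD1 i) //= (bigD1 j) //= -addrA.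
  apply: (@le_trans _ _ (c i * V1 j)); last first.
    by rewrite lerDl addr_ge0 ?sumr_ge0 // => l _; rewrite sumr_ge0.
  have -> : (A ^+ k) i j = (A ^+ k *m delta_mx j 0 : 'cV_n.+1) i 0.
    by rewrite -colE mxE.
  by rewrite (le_trans (hc i _)) // ler_wpM2l.
exists M; split; first exact: ger0_real.
move=> x Mx k _ /=; apply: le_trans (ltW Mx).
(* The max norm is either 0 or attained at an entry. *)
rewrite /Num.norm /=.
by have [->//|/mx_norm_neq0[[i j] ->]] := eqVneq (mx_norm (A ^+ k)) 0.
Qed.

(** * The Debye matrix and the leapfrog energy *)

Lemma conj_ge0 {C : numClosedFieldType} (x : C) : 0 <= x -> x^* = x.
Proof. by move=> x0; rewrite conj_Creal ?ger0_real. Qed.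

(** The amplification matrix with free scalars for sigma, delta and [epss'], which turns the energy
    balances into field identities. *)
Definition debye_matrix {C : numClosedFieldType} (s d e : C) : 'M[C]_3 :=
  \matrix_(i, j)
    (nth [::]
      [:: [:: 1; - s; 0];
          [:: (1 + d) * s^* / (1 + d * e);
              ((1 - d * e) - (1 + d) * `|s| ^+ 2) / (1 + d * e);
              2 * d / (1 + d * e)];
          [:: s^*; - `|s| ^+ 2; 1]] i)`_j.

Lemma debye_matrix_mul {C : numClosedFieldType} (s d e : C) (v : 'cV[C]_3) :
  let w := debye_matrix s d e *m v in
  [/\ w 0 0 = v 0 0 - s * v 1 0,
      w 1 0 = ((1 + d) * s^* * v 0 0
        + ((1 - d * e) - (1 + d) * (s * s^*)) * v 1 0 + 2 * d * v 2 0)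
        / (1 + d * e)
    & w 2 0 = s^* * v 0 0 - s * s^* * v 1 0 + v 2 0].
Proof.
have mulE i : (debye_matrix s d e *m v) i 0 = debye_matrix s d e i 0 * v 0 0
    + debye_matrix s d e i 1 * v 1 0 + debye_matrix s d e i 2 * v 2 0.
  rewrite mxE !big_ord_recl big_ord0 addr0 addrA.
  by do ![congr (_ + _)]; congr (debye_matrix _ _ _ _ _ * v _ _); apply/val_inj.
by rewrite /= !mulE !mxE /= normCK; split; ring.
Qed.

Lemma dominated_entries {C : numClosedFieldType} (V : 'cV[C]_3 -> C) :
  dominated V (fun v => v 0 0) -> dominated V (fun v => v 1 0) ->
  dominated V (fun v => v 2 0 - v 1 0) ->
  forall i, dominated V (fun v => v i 0).
Proof.
move=> h0 h1 h2 [[|[|[|//]]] hi].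
- by apply: eq_dominated h0 => v; congr (v _ _); apply/val_inj.
- by apply: eq_dominated h1 => v; congr (v _ _); apply/val_inj.
- apply: eq_dominated (dominatedD h2 h1) => v; rewrite subrK.
  by congr (v _ _); apply/val_inj.
Qed.

(* For the leapfrog steps b' = b - s e, b'' = b' - s e' this is
   |e|^2 + Re (b' b^* ): the magnetic part is evaluated at two time levels. *)
Definition wave_energy {C : numClosedFieldType} (s b e : C) : C :=
  `|e| ^+ 2 + `|b| ^+ 2 - (s * e * b^* + s^* * e^* * b) / 2.

(** Completing the square in [b] leaves [|b - s e / 2|^2]. *)
Lemma wave_energy_ge_E {C : numClosedFieldType} (s b e : C) :
  (1 - `|s| ^+ 2 / 4) * `|e| ^+ 2 <= wave_energy s b e.
Proof.
rewrite -subr_ge0 /wave_energy (_ : _ - _ = `|b - s * e / 2| ^+ 2) ?exprn_ge0 //.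
rewrite !normCK !(rmorphB, rmorphM, fmorphV, rmorph_nat) /=; by field; rewrite ?pnatr_eq0.
Qed.

(** Completing the square in [e] leaves [|e - s^* b / 2|^2], which is the whole energy when
    [|s|^2 = 4]. *)
Lemma wave_energy_ge_B {C : numClosedFieldType} (s b e : C) :
  (1 - `|s| ^+ 2 / 4) * `|b| ^+ 2 <= wave_energy s b e.
Proof.
rewrite -subr_ge0 /wave_energy (_ : _ - _ = `|e - s^* * b / 2| ^+ 2) ?exprn_ge0 //.
rewrite !normCK !(rmorphB, rmorphM, fmorphV, rmorph_nat) /= ?conjCK; by field; rewrite ?pnatr_eq0.
Qed.

(** * Bounded powers in the three regimes *)

Lemma debye_bounded_cfl {C : numClosedFieldType} (s d e : C) :
  0 < d -> 1 < e -> `|s| ^+ 2 < 4 ->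
  bounded_fun (fun k : nat => debye_matrix s d e ^+ k).
Proof.
move=> d0 e1 s4.
have e0 : 0 < e - 1 by rewrite subr_gt0.
have ege0 : 0 < e by rewrite (lt_trans _ e1).
have k0 : 0 < 1 - `|s| ^+ 2 / 4 by rewrite subr_gt0 ltr_pdivrMr ?mul1r ?ltr0n.
have den0 : 1 + d * e != 0 by rewrite gt_eqF // addr_gt0 // mulr_gt0.
have dc := conj_ge0 _ (ltW d0); have ec := conj_ge0 _ (ltW ege0).
pose V (v : 'cV[C]_3) :=
  wave_energy s (v 0 0) (v 1 0) + `|v 2 0 - v 1 0| ^+ 2 / (e - 1).
have pge0 v : 0 <= `|v 2 0 - v 1 0| ^+ 2 / (e - 1) :> C.
  by rewrite divr_ge0 ?exprn_ge0 // ltW.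
have wge0 b f : 0 <= wave_energy s b f.
  by apply: le_trans (wave_energy_ge_E s b f); rewrite mulr_ge0 ?exprn_ge0 // ltW.
apply: (bounded_powers _ V) => [v|].
  have [w0 w1 w2] := debye_matrix_mul s d e v.
  set w := _ *m v in w0 w1 w2 *.
  pose dp := (w 2 0 - w 1 0) - (v 2 0 - v 1 0).
  rewrite -subr_ge0 (_ : _ - _ = `|dp| ^+ 2 / (d * (e - 1))); last first.
    rewrite /V /wave_energy /dp w0 w1 w2 !normCK.
    rewrite !(rmorphB, rmorphD, rmorphM, fmorphV, rmorph_nat, rmorph1) /= ?conjCK dc ec.
    (* The balance is a rational identity in which entries and their conjugates may be independent
       unknowns. *)
    move: (v 0 0) (v 1 0) (v 2 0) (v 0 0)^* (v 1 0)^* (v 2 0)^* s^*.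
    move=> b f h bs fs hs ss.
    by field; rewrite den0 !gt_eqF.
  by rewrite divr_ge0 ?exprn_ge0 // mulr_ge0 // ltW.
apply: dominated_entries.
- apply: (dominated_ge _ k0) => v; apply: le_trans (wave_energy_ge_B s (v 0 0) (v 1 0)) _.
  by rewrite /V lerDl.
- apply: (dominated_ge _ k0) => v; apply: le_trans (wave_energy_ge_E s (v 0 0) (v 1 0)) _.
  by rewrite /V lerDl.
- apply: (@dominated_ge _ _ _ _ (e - 1)^-1); first by rewrite invr_gt0.
  by move=> v; rewrite mulrC /V lerDr.
Qed.

Lemma debye_bounded_critical {C : numClosedFieldType} (s d e : C) :
  0 < d -> 1 < e -> `|s| ^+ 2 = 4 ->
  bounded_fun (fun k : nat => debye_matrix s d e ^+ k).
Proof.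
move=> d0 e1 s4.
have e0 : 0 < e - 1 by rewrite subr_gt0.
have ege0 : 0 < e by rewrite (lt_trans _ e1).
have den0 : 1 + d * e != 0 by rewrite gt_eqF // addr_gt0 // mulr_gt0.
have dc := conj_ge0 _ (ltW d0); have ec := conj_ge0 _ (ltW ege0).
have sn0 : s != 0.
  by apply/eqP => s0; move/eqP: s4; rewrite s0 normr0 expr0n eq_sym pnatr_eq0.
(* Eliminating [s^*] builds the constraint q = 4 into the identities that [field] checks. *)
have ssE : s^* = 4 / s.
  by apply: (mulfI sn0); rewrite -normCK s4 mulrC divfK.
pose f (v : 'cV[C]_3) := v 1 0 - s^* / 2 * v 0 0.
pose p (v : 'cV[C]_3) := v 2 0 - v 1 0.
(* When q = 4 the energy is |f|^2 + |p|^2 / (e - 1), which vanishes on the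
     eigenvector of eigenvalue -1; [g] is the corresponding left eigenvector,
     so its modulus is conserved. *)
pose g (v : 'cV[C]_3) := s^* / 2 * v 0 0
  + ((1 + d * (e - 1)) * f v - d * p v) / (d * (e - 1)).
pose V v := `|f v| ^+ 2 + `|p v| ^+ 2 / (e - 1) + `|g v| ^+ 2.
have fge0 v : 0 <= `|f v| ^+ 2 by rewrite exprn_ge0.
have pge0 v : 0 <= `|p v| ^+ 2 / (e - 1) by rewrite divr_ge0 ?exprn_ge0 // ltW.
have gge0 v : 0 <= `|g v| ^+ 2 by rewrite exprn_ge0.
apply: (bounded_powers _ V) => [v|].
  have [w0 w1 w2] := debye_matrix_mul s d e v.
  set w := _ *m v in w0 w1 w2 *.
  have gw : g w = - g v.
    rewrite /g /f /p w0 w1 w2 ssE.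
    by field; rewrite den0 sn0 !gt_eqF.
  rewrite /V gw normrN lerD2r.
  rewrite -subr_ge0 (_ : _ - _ = `|p w - p v| ^+ 2 / (d * (e - 1))); last first.
    rewrite /f /p w0 w1 w2 !normCK.
    rewrite !(rmorphB, rmorphD, rmorphM, fmorphV, rmorph_nat, rmorph1) /= ?conjCK dc ec.
    rewrite ssE.
    move: (v 0 0) (v 1 0) (v 2 0) (v 0 0)^* (v 1 0)^* (v 2 0)^*.
    move=> b h k bs hs ks.
    by field; rewrite den0 sn0 !gt_eqF.
  by rewrite divr_ge0 ?exprn_ge0 // mulr_ge0 // ltW.
have df : dominated V f.
  by apply: (dominated_ge _ ltr01) => v; rewrite mul1r /V -addrA lerDl addr_ge0.
have dp : dominated V p.
  apply: (@dominated_ge _ _ _ _ (e - 1)^-1); first by rewrite invr_gt0.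
  by move=> v; rewrite mulrC /V addrAC lerDr addr_ge0.
have dg : dominated V g.
  by apply: (dominated_ge _ ltr01) => v; rewrite mul1r /V lerDr addr_ge0.
(* Removing the [f] and [p] terms from [g] leaves [s^* / 2 * v 0 0]; the factor [s / 2] inverts
   [s^* / 2] since [s * s^* = 4]. *)
have db : dominated V (fun v => v 0 0).
  have dL := dominatedD (dominatedZ (- ((1 + d * (e - 1)) / (d * (e - 1)))) df)
    (dominatedZ (e - 1)^-1 dp).
  apply: eq_dominated (dominatedZ (s / 2) (dominatedD dg dL)) => v.
  by rewrite /g /f /p ssE; field; rewrite sn0 !gt_eqF.
apply: dominated_entries => //.
apply: eq_dominated (dominatedD df (dominatedZ (s^* / 2) db)) => v.
by rewrite /f subrK.
Qed.

Lemma debye_bounded_nondispersive {C : numClosedFieldType} (s d : C) :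
  0 < d -> `|s| ^+ 2 < 4 ->
  bounded_fun (fun k : nat => debye_matrix s d 1 ^+ k).
Proof.
move=> d0 s4.
have k0 : 0 < 1 - `|s| ^+ 2 / 4 by rewrite subr_gt0 ltr_pdivrMr ?mul1r ?ltr0n.
have den0 : 1 + d != 0 by rewrite gt_eqF // addr_gt0.
have dc := conj_ge0 _ (ltW d0).
(* [4 d^2 + q (1 - d^2) = d^2 (4 - q) + q] *)
have D0 : 4 * d ^+ 2 + s * s^* * (1 - d ^+ 2) != 0.
  rewrite -normCK gt_eqF // (_ : _ + _ = d ^+ 2 * (4 - `|s| ^+ 2) + `|s| ^+ 2).
    by rewrite ltr_wpDr ?exprn_ge0 // mulr_gt0 ?exprn_gt0 // subr_gt0.
  by ring.
(* [(y, x, 1 + x)] is the eigenvector of eigenvalue [(1 - d) / (1 + d)]. *)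
pose x := - (4 * d ^+ 2) / (4 * d ^+ 2 + s * s^* * (1 - d ^+ 2)).
pose y := s * x * (1 + d) / (2 * d).
pose p (v : 'cV[C]_3) := v 2 0 - v 1 0.
(* [p] takes the value 1 on this eigenvector, so [p v] is the multiple of it to subtract. *)
pose b (v : 'cV[C]_3) := v 0 0 - y * p v.
pose f (v : 'cV[C]_3) := v 1 0 - x * p v.
pose V v := wave_energy s (b v) (f v) + `|p v| ^+ 2.
have pge0 v : 0 <= `|p v| ^+ 2 by rewrite exprn_ge0.
have wge0 u t : 0 <= wave_energy s u t.
  by apply: le_trans (wave_energy_ge_E s u t); rewrite mulr_ge0 ?exprn_ge0 // ltW.
apply: (bounded_powers _ V) => [v|].
  have [w0 w1 w2] := debye_matrix_mul s d 1 v.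
  set w := _ *m v in w0 w1 w2 *.
  have bw : b w = b v - s * f v.
    rewrite /b /f /y /x /p w0 w1 w2 mulr1.
    by field; rewrite den0 D0 gt_eqF.
  have fw : f w = f v + s^* * b w.
    rewrite bw /b /f /y /x /p w1 w2 mulr1.
    by field; rewrite den0 D0 gt_eqF.
  have pw : p w = (1 - d) / (1 + d) * p v.
    by rewrite /p w1 w2 mulr1; field.
  have r1 : `|(1 - d) / (1 + d)| <= 1.
    rewrite normf_div (ger0_norm (addr_ge0 ler01 (ltW d0))) ler_pdivrMr ?addr_gt0 //.
    by rewrite mul1r (le_trans (ler_normB _ _)) // normr1 gtr0_norm.
  apply: lerD; last first.
    by rewrite pw normrM exprMn ler_piMl ?exprn_ge0 // exprn_ile1.
  (* The leapfrog part conserves its energy exactly. *)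
  rewrite le_eqVlt; apply/orP; left; apply/eqP.
  rewrite fw bw /wave_energy !normCK; move: (b v) (f v) => u t.
  rewrite !(rmorphB, rmorphD, rmorphM, fmorphV, rmorph_nat, rmorph1) /= ?conjCK.
  by field; rewrite ?pnatr_eq0.
have dp : dominated V p.
  by apply: (dominated_ge _ ltr01) => v; rewrite mul1r /V lerDr.
have db : dominated V b.
  apply: (dominated_ge _ k0) => v; apply: le_trans (wave_energy_ge_B s (b v) (f v)) _.
  by rewrite /V lerDl.
have df : dominated V f.
  apply: (dominated_ge _ k0) => v; apply: le_trans (wave_energy_ge_E s (b v) (f v)) _.
  by rewrite /V lerDl.
apply: dominated_entries => //.
- by apply: eq_dominated (dominatedD db (dominatedZ y dp)) => v; rewrite /b subrK.
- by apply: eq_dominated (dominatedD df (dominatedZ x dp)) => v; rewrite /f subrK.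
Qed.

(** * Return to the scheme *)

Lemma amplificationE {R : realType} (p : debye_params R) (xi : R) :
  amplification p xi = debye_matrix (sigma p xi) (real_complex R (del p))
    (real_complex R (epss' p)).
Proof. by []. Qed.

Lemma q_le {R : realType} (p : debye_params R) (xi : R) :
  `|sigma p xi| ^+ 2 <= real_complex R (4 * lam p ^+ 2).
Proof.
have l0 : 0 <= 4 * lam p ^+ 2 by rewrite pmulr_rge0 ?ltr0n // sqr_ge0.
by rewrite -/(q p xi) qE lecR ler_piMr // sin2cos2 lerBlDr lerDl sqr_ge0.
Qed.

Theorem mainTheorem1 (R : realType) (p : debye_params R)
    (eps0_gt0 : 0 < eps0 p) (mu0_gt0 : 0 < mu0 p) (epsinf_gt0 : 0 < epsinf p)
    (tr_gt0 : 0 < tr p) (dt_gt0 : 0 < dt p) (dx_gt0 : 0 < dx p)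
    (epsinf_le_epss : epsinf p <= epss p) :
  (epsinf p < epss p -> dt p <= dx p / cinf p -> von_neumann_stable p) /\
  (epss p = epsinf p -> dt p < dx p / cinf p -> von_neumann_stable p).
Proof.
have c0 : 0 < cinf p by rewrite invr_gt0 sqrtr_gt0 !mulr_gt0.
have l0 : 0 <= lam p by rewrite /lam ltW // divr_gt0 // mulr_gt0.
have d0 : 0 < real_complex R (del p).
  by rewrite ltcR divr_gt0 // mulr_gt0.
have C4 : real_complex R 4 = 4 by exact: rmorph_nat.
split=> [e1 h|e1 h] xi; rewrite amplificationE.
- have e1' : 1 < real_complex R (epss' p).
    by rewrite -(rmorph1 (real_complex R)) ltcR /epss' ltr_pdivlMr ?mul1r.
  (* The time step condition says [lam p <= 1], hence q <= 4; equality is the critical regime. *)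
  have : `|sigma p xi| ^+ 2 <= 4.
    apply: le_trans (q_le p xi) _; rewrite -C4 lecR ler_piMr // exprn_ile1 //.
    by rewrite /lam ler_pdivrMr // mul1r mulrC -ler_pdivlMr.
  rewrite le_eqVlt => /orP[/eqP|] s4.
    exact: debye_bounded_critical.
  exact: debye_bounded_cfl.
- have -> : real_complex R (epss' p) = 1 by rewrite /epss' e1 divff // gt_eqF.
  apply: debye_bounded_nondispersive => //.
  (* Here [lam p < 1] keeps q strictly below 4, so the leapfrog energy is definite. *)
  apply: le_lt_trans (q_le p xi) _; rewrite -C4 ltcR gtr_pMr // exprn_ilt1 //.
  by rewrite /lam ltr_pdivrMr // mul1r mulrC -ltr_pdivlMr.
Qed.
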